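(* Let $n\in\mathbb{N}$, let $X$ and $Y$ be proper metric spaces and let $f\colon X\to Y$ be coarse, coarsely open, coarsely $n$-to-$1$ and coarsely surjective. Then $$\mathrm{asdim}(Y)=\mathrm{asdim}(X).$$
   Context: $\mathbb{N}=\{1,2,\ldots\}$. A metric space is proper if the closure of each bounded set is compact. A map $f\colon X\to Y$ of metric spaces (not necessarily continuous) is proper if preimages of bounded sets are bounded. It is coarse if it is proper and for each $R>0$ there exists $S>0$ such that $d(x,y)\le R$ implies $d(f(x),f(y))\le S$. It is coarsely surjective if there exists $R$ such that $\inf_{a\in f(X)}d(y,a)\le R$ for all $y\in Y$. It is coarsely $n$-to-$1$ if for each $R>0$ there exists $S>0$ such that for each $A\subset Y$ of diameter at most $R$, the preimage $f^{-1}(A)$ can be covered by at most $n$ subsets of $X$ of diameter at most $S$. A function $\rho\colon[0,\infty)\to[0,\infty)$ is TI-increasing if it is (not necessarily strictly) increasing and $\lim_{t\to\infty}\rho(t)=\infty$. Each space carries a fixed basepoint ($x_0\in X$, and likewise a basepoint in $Y$). Let $N(x,R)$ be the closed ball of radius $R$ about $x$. For $A\subset X$ and TI-increasing $\rho$ put $N(A,\rho)=\bigcup_{x\in A}N\big(x,\rho(d(x,x_0))\big)$, and similarly in $Y$ with its basepoint. A map $f\colon X\to Y$ between proper metric spaces is coarsely open if for each unbounded $A\subset X$ and each TI-increasing $\rho$ there exists a TI-increasing $\tilde\rho$ such that $N(f(A),\tilde\rho)\subset f(N(A,\rho))$. The asymptotic dimension $\mathrm{asdim}(X)\in\{0,1,2,\ldots\}\cup\{\infty\}$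 is the smallest integer $m\geq 0$ such that for every $r>0$ there is a cover of $X$ by sets of uniformly bounded diameter such that every subset of $X$ of diameter at most $r$ meets at most $m+1$ of them ($\infty$ if no such $m$ exists). *)

(* Defs.v *)
From HB Require Import structures.
From mathcomp Require Import all_boot all_order all_algebra.
From mathcomp Require Import all_classical all_reals all_analysis.

Set Implicit Arguments.
Unset Strict Implicit.
Unset Printing Implicit Defensive.

Import Order.TTheory GRing.Theory Num.Theory.
Import numFieldNormedType.Exports.

Local Open Scope classical_set_scope.
Local Open Scope card_scope.
Local Open Scope ring_scope.

Section Spaces.
Context {R : realType} {X : metricType R}.
Implicit Types (A B : set X) (x : X) (r : R).

(* [diam set0 = -oo]; diameters are only compared with upper bounds, so this
   agrees with the convention that the empty set has diameter 0. *)
Definition diam A : \bar R :=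
  ereal_sup [set (mdist p.1 p.2)%:E | p in A `*` A].

Definition bounded A : Prop := (diam A < +oo)%E.

(* The library's [closed_ball] is the closure of the open ball, which may be
   smaller than this set in a general metric space. *)
Definition cball x r : set X := [set y | mdist x y <= r].

Definition variable_nbhd x0 A (rho : R -> R) : set X :=
  \bigcup_(x in A) cball x (rho (mdist x x0)).

End Spaces.

Definition proper_space {R : realType} (X : metricType R) : Prop :=
  forall A : set X, bounded A -> compact (closure A).

(* A function [0, oo) -> [0, oo) is encoded by any extension of it to R; the
   values at negative arguments are unconstrained and never used. *)
Definition TI_increasing {R : realType} (rho : R -> R) : Prop :=
  [/\ forall t, 0 <= t -> 0 <= rho t,
      forall s t, 0 <= s -> s <= t -> rho s <= rho t
    & rho t @[t --> +oo] --> +oo].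

Section Maps.
Context {R : realType} {X Y : metricType R}.
Implicit Types (f : X -> Y) (n : nat).

Definition proper_map f : Prop :=
  forall B : set Y, bounded B -> bounded (f @^-1` B).

Definition coarse f : Prop :=
  proper_map f /\
  forall r : R, 0 < r -> exists2 s : R, 0 < s &
    forall x y, mdist x y <= r -> mdist (f x) (f y) <= s.

Definition coarsely_surjective f : Prop :=
  exists r : R, forall y, inf [set mdist y a | a in range f] <= r.

Definition coarsely_n_to_1 n f : Prop :=
  forall r : R, 0 < r -> exists2 s : R, 0 < s &
    forall A : set Y, (diam A <= r%:E)%E ->
      exists2 B : 'I_n -> set X, forall i, (diam (B i) <= s%:E)%E &
        f @^-1` A `<=` \bigcup_i B i.

Definition coarsely_open (x0 : X) (y0 : Y) f : Prop :=
  forall (A : set X) (rho : R -> R), ~ bounded A -> TI_increasing rho ->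
    exists2 rho' : R -> R, TI_increasing rho' &
      variable_nbhd y0 (f @` A) rho' `<=` f @` variable_nbhd x0 A rho.

End Maps.

Definition asdim_le {R : realType} (X : metricType R) (m : nat) : Prop :=
  forall r : R, 0 < r -> exists U : set (set X),
    [/\ \bigcup_(A in U) A = [set: X],
        exists s : R, forall A, U A -> (diam A <= s%:E)%E
      & forall B : set X, (diam B <= r%:E)%E ->
          [set A | U A /\ A `&` B !=set0] #<= `I_m.+1].

(* An infimum of natural numbers is their minimum, or +oo if there are none. *)
Definition asdim {R : realType} (X : metricType R) : \bar R :=
  ereal_inf [set m%:R%:E | m in asdim_le X].

(* Main.v *)
Require Import Defs.
From mathcomp Require Import all_boot all_order all_algebra.
From mathcomp Require Import all_classical all_reals all_analysis.
From mathcomp Require Import lra.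

(** The asymptotic dimension is handled through colourings: it is at most [m] if
    and only if, at every scale [r], the space is a union of [m.+1] sets in each
    of which the [r]-chains move by a bounded amount
    ([asdim_le_uniform_dim], [uniform_dim_asdim_le]).

    A colouring of [Y] pulls back to [X]: an [r]-chain of one colour in [X] is
    sent into a bounded set, hence lies in a union of [n] sets of controlled
    diameter, and so is bounded itself ([uniform_dim_domain]). So the dimension of [X] is at most that of
    [Y].

    For the converse, coarse openness is first turned into a lifting property
    with constants ([coarsely_open_lift]): if [f x] is close to [y], then some
    point at controlled distance from [x] is sent within [R0] of [y], where [R0]
    does not depend on how close. Hence the coarse fibres
    [F y = [set x | mdist (f x) y <= R0]] vary with [y] in a controlled way for
    the Hausdorff distance, each of them being covered by [n] balls of fixed
    radius. The space [Y] is then stratified by the number of clusters of [F y].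
    Where the clusters are separated by a large gap [b], a cluster can be
    followed along a bounded subset of [Y], which is thereby identified with a
    subset of [X] and inherits its colourings ([gap_local_dim]). Where they are
    not, two of them merge, which leaves a fibre with fewer clusters of a larger
    size ([few_ballsS]), and induction applies ([few_balls_dim]).

    Two points need care. Both the strata and the bounded pieces of a stratum are
    put together with the union lemma [scale_dim_setU], which wants the scales to
    be chosen in the right order. And a stratum is cut into infinitely many
    bounded pieces, which can be handled only if finitely many colours suffice to
    keep pieces of the same colour apart, at all scales
    ([scale_dim_local_to_global]); and [Y] needs at most [n] times as many
    colours as [X] ([correspondence_finite_dim]). *)

Set Implicit Arguments.
Unset Strict Implicit.
Unset Printing Implicit Defensive.

Import Order.TTheory GRing.Theory Num.Theory.
Import numFieldNormedType.Exports.

Local Open Scope classical_set_scope.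
Local Open Scope ring_scope.

(** * Diameters and chains *)

Section Chains.
Context {R : realType} {X : metricType R}.
Implicit Types (A B Z : set X) (x y z : X) (r D : R) (k : nat).

Definition diam_le A D := forall x y, A x -> A y -> mdist x y <= D.

Lemma diam_leP A D : (diam A <= D%:E)%E <-> diam_le A D.
Proof.
split=> [AD x y Ax Ay|AD].
  rewrite -lee_fin; apply: le_trans AD.
  by apply: ereal_sup_ubound; exists (x, y).
by apply: ge_ereal_sup => _ [[x y] [/= Ax Ay] <-]; rewrite lee_fin; apply: AD.
Qed.

Lemma boundedP A : bounded A <-> exists D, diam_le A D.
Proof.
split=> [|[D /diam_leP AD]]; last exact: le_lt_trans AD (ltry _).
rewrite /bounded; case E : (diam A) => [D| |] // _.
  by exists D; apply/diam_leP; rewrite E.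
by exists 0; apply/diam_leP; rewrite E leNye.
Qed.

Lemma bounded_in_ball A x r : (forall y, A y -> mdist x y <= r) -> bounded A.
Proof.
move=> Ar; apply/boundedP; exists (r + r) => y z /Ar xy /Ar xz.
by apply: le_trans (metric_triangle _ x _) _; rewrite metric_sym lerD.
Qed.

Inductive chain A r x : X -> Prop :=
| chain_start : A x -> chain A r x x
| chain_step y z : chain A r x y -> A z -> mdist y z <= r -> chain A r x z.

Lemma chain_first A r x y : chain A r x y -> A x.
Proof. by elim. Qed.

Lemma chain_last A r x y : chain A r x y -> A y.
Proof. by case. Qed.

Lemma chain_sub A B r s x y :
  A `<=` B -> r <= s -> chain A r x y -> chain B s x y.
Proof.
move=> AB rs; elim=> [/AB Bx|y' z _ IH /AB Bz yz]; first exact: chain_start.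
by apply: chain_step IH Bz (le_trans yz rs).
Qed.

Lemma chain_trans A r x y z : chain A r x y -> chain A r y z -> chain A r x z.
Proof. by move=> xy; elim=> // y' z' _ IH Az yz; apply: chain_step IH Az yz. Qed.

Lemma chain_sym A r x y : chain A r x y -> chain A r y x.
Proof.
elim=> [|y' z xy IH Az yz]; first exact: chain_start.
apply: chain_trans IH; apply: chain_step (chain_start _ Az) (chain_last xy) _.
by rewrite metric_sym.
Qed.

Definition chain_bounded A r D := forall x y, chain A r x y -> mdist x y <= D.

Lemma chain_bounded_sub A B r s D :
  A `<=` B -> r <= s -> chain_bounded B s D -> chain_bounded A r D.
Proof. by move=> AB rs Bb x y /(chain_sub AB rs)/Bb. Qed.

(** A chain in the union is cut at its visits to [A2]: consecutive visits are
    separated by an excursion into [A1], which moves by at most [D1], so the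
    visits themselves form a chain in [A2] at the coarser scale [r2]. *)
Lemma chain_bounded_setU A1 A2 r1 r2 D1 D2 :
  0 <= r1 -> 0 <= D1 -> 0 <= D2 -> D1 + r1 + r1 <= r2 ->
  chain_bounded A1 r1 D1 -> chain_bounded A2 r2 D2 ->
  chain_bounded (A1 `|` A2) r1 (D2 + 2 * (D1 + r1)).
Proof.
move=> r10 D10 D20 r12 b1 b2.
pose near y q := y = q \/ exists2 y', mdist q y' <= r1 & chain A1 r1 y' y.
have nearD y q : near y q -> mdist q y <= D1 + r1.
  case=> [->|[y' qy' /b1 y'y]]; first by rewrite mdistxx; lra.
  by have := metric_triangle q y' y; lra.
have cut x y : chain (A1 `|` A2) r1 x y ->
    chain A1 r1 x y \/ exists p q,
    [/\ mdist x p <= D1 + r1, chain A2 r2 p q & near y q].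
  elim=> [[Ax|Ax]|y' z xy IH Az yz].
  - by left; exact: chain_start.
  - right; exists x, x; split; [by rewrite mdistxx; lra|exact: chain_start|].
    by left.
  case: Az => Az; case: IH => [xy1|[p [q [xp pq y'q]]]].
  - by left; exact: chain_step xy1 Az yz.
  - right; exists p, q; split=> //; right; case: y'q => [<-|[w qw wy]].
      by exists z => //; exact: chain_start.
    by exists w => //; exact: chain_step wy Az yz.
  - right; exists z, z; split; [|exact: chain_start|by left].
    by have := metric_triangle x y' z; have := b1 _ _ xy1; lra.
  - right; exists p, z; split=> //; last by left.
    apply: chain_step pq Az _.
    by have := metric_triangle q y' z; have := nearD _ _ y'q; lra.
move=> x y /cut[/b1|[p [q [xp /b2 pq /nearD qy]]]]; first by lra.
by have := metric_triangle x p y; have := metric_triangle p q y; lra.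
Qed.

(** Balls are added one at a time, and [chain_bounded_setU] applies however
    coarse the scale at which the last ball is looked at, as any chain inside a
    ball moves by at most its diameter. *)
Lemma chain_bounded_cover k r S : 0 <= r -> 0 <= S ->
  exists2 D, 0 <= D & forall A (s : seq X), (size s <= k)%N ->
    (forall z, A z -> exists2 c, c \in s & mdist c z <= S) ->
    chain_bounded A r D.
Proof.
move=> r0 S0; elim: k => [|k [D D0 IH]].
  by exists 0 => // A [|//] _ cov x y /chain_last/cov[].
exists (S + S + 2 * (D + r)); first lra.
move=> A [|c s] /= sk cov; first by move=> x y /chain_last/cov[].
pose far := A `&` [set z | ~ mdist c z <= S].
pose close := A `&` [set z | mdist c z <= S].
apply: (@chain_bounded_sub _ (far `|` close) _ r) => //.
  by move=> z Az; case: (pselect (mdist c z <= S)) => ?; [right|left].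
apply: (@chain_bounded_setU _ _ _ (D + r + r)) => //; first lra.
  apply: IH sk _ => z [/cov[d]]; rewrite inE => /predU1P[->|]; first by [].
  by exists d.
move=> x y xy; have [_ /= cx] := chain_first xy.
have [_ /= cy] := chain_last xy.
by have := metric_triangle x c y; rewrite (metric_sym x c); lra.
Qed.

End Chains.

(** * Coverings at a given scale and asymptotic dimension *)

Lemma card_le_II_seq (T : choiceType) (A : set T) N : (A #<= `I_N)%card ->
  exists2 s : seq T, (size s <= N)%N & forall i, A i -> i \in s.
Proof.
move=> AN; have finA : finite_set A by apply/finite_set_leP; exists N.
exists (finmap.enum_fset (fset_set A)).
  by move/geq_card_fset_set: AN.
by move=> i Ai; have := mem_set Ai; rewrite -in_fset_set.
Qed.

(** Each strict inclusion brings a new member of [s], so [N] of them after a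
    nonempty start would give [N.+1] distinct members. *)
Lemma increasing_sets_stop (I : eqType) (s : seq I) (S : nat -> set I) N :
  (size s <= N)%N -> (forall j i, S j i -> S j.+1 i) -> S 0%N !=set0 ->
  (forall j i, (j <= N)%N -> S j i -> i \in s) ->
  exists2 j, (j < N)%N & S j.+1 `<=` S j.
Proof.
move=> sN Smono [i0 S0] Ss; apply: contrapT => noj.
have {}noj j : (j < N)%N -> exists i, S j.+1 i /\ ~ S j i.
  move=> jN; apply: contrapT => H; apply: noj; exists j => // i Si.
  by apply: contrapT => nSi; apply: H; exists i.
have build j : (j <= N)%N -> exists t : seq I,
    [/\ uniq t, size t = j.+1 & forall i, i \in t -> S j i].
  elim: j => [_|j IH jN].
    by exists [:: i0]; split=> // i; rewrite inE => /eqP->.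
  have [t [ut st tS]] := IH (ltnW jN); have [i [Si nSi]] := noj _ jN.
  exists (i :: t); split=> /=; last 2 first.
  - by rewrite st.
  - by move=> l; rewrite inE => /predU1P[->//|/tS]; exact: Smono.
  by rewrite ut andbT; apply/negP => /tS.
have [t [ut st tS]] := build N (leqnn N).
have : (size t <= size s)%N by apply: uniq_leq_size => // i /tS; exact: Ss.
by rewrite st => /leq_trans/(_ sN); rewrite ltnn.
Qed.

Section ScaleDim.
Context {R : realType} {X : metricType R}.
Implicit Types (A B Z : set X) (x y z : X) (r D : R) (k : nat).

(** The [r]-chain components of [A i] stand for the usual [r]-disjoint bounded
    family of the [i]-th colour. *)
Definition scale_dim k r D Z := 0 <= D /\
  exists2 A : nat -> set X, forall i, (i < k)%N -> chain_bounded (A i) r D &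
    forall x, Z x -> exists2 i, (i < k)%N & A i x.

Lemma scale_dim_sub k r r' D D' Z Z' : r' <= r -> D <= D' -> Z' `<=` Z ->
  scale_dim k r D Z -> scale_dim k r' D' Z'.
Proof.
move=> rr DD ZZ [D0 [A Ab AZ]]; split; first exact: le_trans DD.
exists A => [i /Ab b x y xy|x /ZZ/AZ//].
by apply: le_trans DD; apply: b; exact: chain_sub xy.
Qed.

Lemma scale_dim0 k r : scale_dim k r 0 set0.
Proof.
by split=> //; exists (fun=> set0) => // i _ x y /chain_first.
Qed.

Lemma scale_dim_setU k r1 r2 D1 D2 Z1 Z2 : 0 <= r1 -> D1 + r1 + r1 <= r2 ->
  scale_dim k r1 D1 Z1 -> scale_dim k r2 D2 Z2 ->
  scale_dim k r1 (D2 + 2 * (D1 + r1)) (Z1 `|` Z2).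
Proof.
move=> r10 r12 [D10 [A1 b1 c1]] [D20 [A2 b2 c2]]; split; first lra.
exists (fun i => A1 i `|` A2 i) => [i ik|x [/c1|/c2] [i ik Ai]].
- by apply: (chain_bounded_setU r10 D10 D20 r12); [exact: b1|exact: b2].
- by exists i => //; left.
- by exists i => //; right.
Qed.

(** The pieces are more than [r] apart, so the coverings of the different pieces
    can be combined. *)
Lemma scale_dim_components k r r' D Z : r <= r' -> 0 <= D ->
  (forall x, Z x -> scale_dim k r D [set y | chain Z r' x y]) ->
  scale_dim k r D Z.
Proof.
move=> rr' D0 pieces; pose comp x := [set y | chain Z r' x y].
have compE x y : chain Z r' x y -> comp x = comp y.
  move=> xy; apply/seteqP; split=> z; last exact: chain_trans.
  by apply: chain_trans; exact: chain_sym.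
have /choice[A AP] (P : set X) : exists A : nat -> set X,
    (exists2 x, Z x & P = comp x) ->
    (forall i, (i < k)%N -> chain_bounded (A i) r D) /\
    (forall x, P x -> exists2 i, (i < k)%N & A i x).
  have [[x Zx ->]|nP] := pselect (exists2 x, Z x & P = comp x).
    by have [_ [A ? ?]] := pieces x Zx; exists A.
  by exists (fun=> set0) => /nP.
split=> //; exists (fun i => Z `&` [set x | A (comp x) i x]).
  move=> i ik x y xy; have [Zx _] := chain_first xy.
  have [/(_ i ik) b _] := AP _ (ex_intro2 _ _ x Zx erefl); apply: b.
  suff [] : chain Z r' x y /\ chain (A (comp x) i) r x y by [].
  elim: xy => [[_ /= Ax]|y' z _ [xy1 xy2] [Zz Az] yz].
    by split; exact: chain_start.
  have xz : chain Z r' x z by apply: chain_step xy1 Zz (le_trans yz rr').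
  by split=> //; apply: chain_step xy2 _ yz; rewrite (compE _ _ xz).
move=> x Zx; have [_ c] := AP _ (ex_intro2 _ _ x Zx erefl).
by have [|i ik Ax] := c x; [exact: chain_start|exists i].
Qed.

Definition uniform_dim k := forall r, 0 < r -> exists D, scale_dim k r D setT.

(** Let [near j x] be the set of indices [i] such that [U i] comes within [j * r]
    of [x]. It increases with [j] and has at most [N] elements for [j <= N], so
    it stops growing at some level [j < N], which serves as the colour of [x].
    If [x] and [y] have the same colour [j] and are within [r] of each other,
    then [near j x] is contained in [near j.+1 y], which is [near j y]; hence
    [near j] is constant along every chain of colour [j]. *)
Lemma scale_dim_cover (I : eqType) (U : I -> set X) N r D : 0 <= r -> 0 <= D ->
  (forall x, exists i, U i x) -> (forall i, diam_le (U i) D) ->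
  (forall x, exists2 s : seq I, (size s <= N)%N &
     forall i, (exists2 y, U i y & mdist x y <= N%:R * r) -> i \in s) ->
  exists D', scale_dim N r D' setT.
Proof.
move=> r0 D0 cov UD mult.
pose near j x : set I := [set i | exists2 y, U i y & mdist x y <= j%:R * r].
have nearS j x : near j x `<=` near j.+1 x.
  by move=> i [y Uy xy]; exists y => //; rewrite -natr1 mulrDl mul1r; lra.
have near_leq j l x : (j <= l)%N -> near j x `<=` near l x.
  by move=> /subnK <-; elim: (l - j)%N => // d IH i /IH/nearS.
have near_step j x y : mdist x y <= r -> near j x `<=` near j.+1 y.
  move=> xy i [z Uz xz]; exists z => //; rewrite -natr1 mulrDl mul1r.
  by have := metric_triangle y x z; rewrite (metric_sym y x); lra.
have near0 j x : near j x !=set0.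
  have [i Ui] := cov x; exists i; exists x => //.
  by rewrite mdistxx mulr_ge0// ler0n.
have N0 : 0 <= N%:R * r by rewrite mulr_ge0// ler0n.
exists (D + 2 * (N%:R * r)); split; first lra.
exists (fun j => [set x | near j.+1 x `<=` near j x]).
  move=> j jN x y xy.
  have same : near j x = near j y.
    elim: xy => // y' z /chain_last /= Ay -> Az yz; apply/seteqP; split.
      by move=> i /(near_step _ _ _ yz)/Az.
    by rewrite metric_sym in yz; move=> i /(near_step _ _ _ yz)/Ay.
  have [i nx] := near0 j x; have := nx; rewrite same => ny.
  have [u Uu xu] := near_leq _ _ _ (ltnW jN) _ nx.
  have [v Uv yv] := near_leq _ _ _ (ltnW jN) _ ny.
  have := UD _ _ _ Uu Uv; have := metric_triangle x u y.
  by have := metric_triangle u v y; rewrite (metric_sym v y); lra.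
move=> x _; have [s sN xs] := mult x.
have [||j i jN|j jN stop] := increasing_sets_stop (S := near ^~ x) sN.
- by move=> j i; exact: nearS.
- exact: near0.
- by move=> /near_leq => /(_ _ jN)/xs.
- by exists j.
Qed.

Lemma asdim_le_uniform_dim m : asdim_le X m -> uniform_dim m.+1.
Proof.
move=> dimX r r0; set l := m.+1%:R * r.
have l0 : 0 < l by rewrite mulr_gt0// ltr0n.
have [U [covU [D UD] mult]] : exists U : set (set X),
    [/\ \bigcup_(A in U) A = [set: X],
        exists s : R, forall A, U A -> (diam A <= s%:E)%E
      & forall B : set X, (diam B <= (l + l)%:E)%E ->
          ([set A | U A /\ A `&` B !=set0] #<= `I_m.+1)%card].
  by apply: dimX; lra.
pose V (A : set X) : set X := [set x | U A /\ A x].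
apply: (@scale_dim_cover (set X) V m.+1 r `|D|) => //; first exact: ltW.
- move=> x; have : [set: X] x by [].
  by rewrite -covU => -[A UA Ax]; exists A.
- move=> A x y [UA Ax] [_ Ay]; apply: le_trans (ler_norm D).
  by have /diam_leP := UD _ UA; exact.
- move=> x; have /mult/card_le_II_seq [s sm sP] :
      (diam [set y | (mdist x y <= l)%R] <= (l + l)%:E)%E.
    apply/diam_leP => y z /= xy xz.
    by have := metric_triangle y x z; rewrite (metric_sym y x); lra.
  by exists s => // A [y [UA Ay] xy]; apply: sP; split=> //; exists y.
Qed.

Lemma uniform_dim_asdim_le m : uniform_dim m.+1 -> asdim_le X m.
Proof.
move=> dimX r r0; have [D [D0 [A Ab AX]]] := dimX r r0.
exists [set P | exists i x, [/\ (i < m.+1)%N, A i x &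
                                P = [set y | chain (A i) r x y]]]; split.
- apply/seteqP; split=> // x _; have [i im Ax] := AX x I.
  exists [set y | chain (A i) r x y]; first by exists i, x.
  exact: chain_start.
- exists D => _ [i [x [im Ax ->]]]; apply/diam_leP => y z /= xy xz.
  by apply: (Ab i im); apply: chain_trans xz; exact: chain_sym.
- move=> B /diam_leP Br.
  (* A set of diameter at most [r] meets a single component of each colour. *)
  pose comp i := [set y | exists2 b, B b & chain (A i) r b y].
  apply: card_le_trans (card_image_le comp `I_m.+1); apply: subset_card_le.
  move=> _ [[i [x [im Ax ->]]] [b [/= xb Bb]]]; exists i => //.
  apply/seteqP; split=> y.
    move=> [c Bc cy]; apply: chain_trans (cy).
    by apply: chain_step xb (chain_first cy) _; exact: Br.
  by move=> /= xy; exists b => //; apply: chain_trans xy; exact: chain_sym.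
Qed.

End ScaleDim.

(** * From bounded sets to the whole space *)

(** Cut the space into bounded pieces of finitely many colours, with pieces of
    the same colour far apart. Within one colour the pieces can be covered
    independently, and the colours are added one by one with [scale_dim_setU],
    which asks each new colour to be covered at a coarser scale than the bound
    reached so far. Since [D] in the hypothesis does not depend on [delta], all
    these scales can be fixed before the pieces are chosen, and [b] last. *)
Lemma scale_dim_local_to_global (R : realType) (X : metricType R) k N
    (G : R -> set X) :
  (forall b b', b <= b' -> G b' `<=` G b) -> uniform_dim (X := X) N ->
  (forall r, 0 < r -> exists D, forall delta, exists b, forall P,
     P `<=` G b -> diam_le P delta -> scale_dim k r D P) ->
  forall r, 0 < r -> exists D b, scale_dim k r D (G b).
Proof.
move=> Gmono dimX local.
have colours j : forall r, 0 < r -> exists2 rho, 0 < rho & exists D,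
    forall delta, exists b, forall C : nat -> set X,
    (forall i, (i < j)%N -> chain_bounded (C i) rho delta) ->
    scale_dim k r D (G b `&` [set x | exists2 i, (i < j)%N & C i x]).
  elim: j => [r r0|j IH r r0].
    exists 1 => //; exists 0 => delta; exists 0 => C _.
    apply: scale_dim_sub (scale_dim0 k r) => //.
    by move=> x [_ [i]]; rewrite ltn0.
  have [D1 loc] := local r r0.
  have D10 : 0 <= D1.
    by have [b /(_ set0)[]] := loc 0.
  have [|rho rho0 [D2 rest]] := IH (D1 + r + r); first lra.
  exists (Num.max r rho); first by rewrite lt_max r0.
  exists (D2 + 2 * (D1 + r)) => delta.
  have [b1 loc1] := loc delta; have [b2 rest2] := rest delta.
  exists (Num.max b1 b2) => C Cb.
  have G1 : G (Num.max b1 b2) `<=` G b1 by apply: Gmono; rewrite le_max lexx.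
  have G2 : G (Num.max b1 b2) `<=` G b2.
    by apply: Gmono; rewrite le_max lexx orbT.
  have last_colour : scale_dim k r D1 (G (Num.max b1 b2) `&` C j).
    apply: (@scale_dim_components _ _ _ _ (Num.max r rho)) => //.
      by rewrite le_max lexx.
    move=> x _; apply: loc1 => [y /chain_last[/G1]//|y z xy xz].
    apply: (Cb j (ltnSn j)); apply: (@chain_trans _ _ _ _ _ x).
      by apply: chain_sym; apply: chain_sub xy => // ? [].
    by apply: chain_sub xz => // ? [].
  have := scale_dim_setU (ltW r0) (lexx _) last_colour (rest2 C _).
  have Cb' i : (i < j)%N -> chain_bounded (C i) rho delta.
    move=> ij; apply: chain_bounded_sub (Cb i (ltnW ij)) => //.
    by rewrite le_max lexx orbT.
  move=> /(_ Cb'); apply: scale_dim_sub => // x [Gx [i]].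
  rewrite ltnS leq_eqVlt => /predU1P[->|ij] Cx; first by left.
  by right; split; [exact: G2|exists i].
move=> r r0; have [rho rho0 [D col]] := colours N r r0.
have [delta [_ [C Cb CX]]] := dimX rho rho0; have [b colb] := col delta.
exists D, b; apply: scale_dim_sub (colb C Cb) => // x Gx.
by split=> //; have [i iN Cx] := CX x I; exists i.
Qed.

(** * Controlled multivalued maps with boundedly many clusters *)

Section Correspondence.
Context {R : realType} {X Y : metricType R} {n : nat} {F : Y -> set X}.
Implicit Types (x : X) (y : Y) (a b r : R) (k j : nat).

Context (F_neq0 : forall y, F y !=set0)
  (F_continuous : forall r, 0 < r -> exists S, forall y y' x,
     mdist y y' <= r -> F y x -> exists2 x', F y' x' & mdist x x' <= S)
  (F_covered : forall r, 0 < r -> exists2 S, 0 < S & forall y,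
     exists2 s : seq X, (size s <= n)%N & forall y' x,
       mdist y y' <= r -> F y' x -> exists2 c, c \in s & mdist c x <= S)
  (F_inverse : forall r, 0 < r -> exists D, forall y y' x x',
     F y x -> F y' x' -> mdist x x' <= r -> mdist y y' <= D).

(** The images of the components of a colouring of [X] cover [Y]. Near [y] they
    come from components close to one of the [n] balls that cover the values of
    [F] there, and a ball is close to a single component of each colour. *)
Lemma correspondence_finite_dim k :
  uniform_dim (X := X) k -> uniform_dim (X := Y) (n * k).
Proof.
move=> dimX r r0; have l0 : 0 < (n * k)%:R * r + r.
  by rewrite ltr_wpDl// mulr_ge0 ?ler0n// ltW.
have [S S0 cov] := F_covered l0.
have [|D [D0 [A Ab AX]]] := dimX (S + S); first lra.
have [|D' FD'] := F_inverse (r := D + 1); first lra.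
pose comp i x := [set z | chain (A i) (S + S) x z].
pose U (P : set X) : set Y := [set y | exists i x,
  [/\ (i < k)%N, A i x, P = comp i x & F y x]].
apply: (@scale_dim_cover _ _ (set X) U (n * k) r `|D'|) => //; first lra.
- move=> y; have [x Fx] := F_neq0 y; have [i ik Ax] := AX x I.
  by exists (comp i x), i, x.
- move=> P y y' [i [x [ik Ax -> Fx]]] [i' [x' [_ Ax' E Fx']]].
  have xx' : comp i x x' by rewrite E; exact: chain_start.
  apply: le_trans (ler_norm D'); apply: FD' Fx Fx' _.
  by have := Ab i ik _ _ xx'; lra.
- move=> y; have [s sn sP] := cov y.
  pose close i c := [set z | exists2 x, mdist c x <= S & comp i x z].
  exists [seq close i c | c <- s, i <- iota 0 k].
    by rewrite size_allpairs size_iota leq_mul2r sn orbT.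
  move=> P [y' [i [x [ik Ax -> Fx]]] yy'].
  have [|c cs cx] := sP y' x _ Fx; first lra.
  apply/allpairsP; exists (c, i); split=> //=.
    by rewrite mem_iota.
  apply/seteqP; split=> z; first by exists x.
  move=> [w cw wz]; apply: chain_trans (wz).
  apply: chain_step (chain_start _ Ax) (chain_first wz) _.
  by have := metric_triangle x c w; rewrite (metric_sym x c); lra.
Qed.

(** For [b] much larger than [a]: the points whose value splits into clusters of
    diameter at most [a] that are more than [b] apart. *)
Definition gap a b : set Y :=
  [set y | forall x x', F y x -> F y x' -> mdist x x' <= b -> mdist x x' <= a].

(** Over a bounded set [P], choose [g y] in [F y] close to one fixed point of
    [X]. If [b] is large against the diameter of [P], the points of [F y] within
    a bounded distance of [g y] are within [a] of it. The value [g y'] at a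
    neighbour [y'] of [y] is close to some point of [F y], hence to [g y], so [g]
    is coarse on [P] with constants that do not depend on [P], and a covering of
    [X] can be pulled back along [g]. *)
Lemma gap_local_dim k a : uniform_dim (X := X) k ->
  forall r, 0 < r -> exists D, forall delta, exists b, forall P,
    P `<=` gap a b -> diam_le P delta -> scale_dim k r D P.
Proof.
move=> dimX r r0; have [S FS] := F_continuous r0.
have [|D [D0 [A Ab AX]]] := dimX (`|S| + `|a| + 1).
  by rewrite ltr_wpDl// addr_ge0.
have [|D' FD'] := F_inverse (r := D + 1); first lra.
exists `|D'| => delta.
have [|T FT] := F_continuous (r := `|delta| + 1); first by rewrite ltr_wpDl.
exists (S + T + T) => P Pgap Pdelta.
have [[y0 Py0]|P0] := pselect (P !=set0); last first.
  by apply: scale_dim_sub (scale_dim0 k r) => // y Py; case: P0; exists y.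
have [x0 Fx0] := F_neq0 y0.
have /choice[g gP] y : exists x, P y -> F y x /\ mdist x0 x <= T.
  have [Py|nPy] := pselect (P y); last by exists x0.
  have [|x Fx x0x] := FT y0 y x0 _ Fx0; last by exists x.
  by have := Pdelta _ _ Py0 Py; have := ler_norm delta; lra.
have g_step y y' : P y -> P y' -> mdist y y' <= r ->
    mdist (g y) (g y') <= `|S| + `|a| + 1.
  move=> Py Py' yy'; have [[Fy gy] [Fy' gy']] := (gP y Py, gP y' Py').
  have [z Fz gyz] := FS _ _ _ yy' Fy.
  have := Pgap _ Py' z (g y') Fz Fy'.
  have := metric_triangle z (g y) (g y'); have := metric_triangle (g y) x0 (g y').
  rewrite (metric_sym z (g y)) (metric_sym (g y) x0) => t1 t2 small.
  have {}small : mdist z (g y') <= a by apply: small; lra.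
  have := metric_triangle (g y) z (g y').
  by have := ler_norm S; have := ler_norm a; lra.
split=> //; exists (fun i => P `&` [set y | A i (g y)]).
  move=> i ik y y' yy'; have [Py _] := chain_first yy'.
  have [Py' _] := chain_last yy'.
  apply: le_trans (ler_norm D'); apply: FD' (gP _ Py).1 (gP _ Py').1 _.
  suff /(Ab i ik) : chain (A i) (`|S| + `|a| + 1) (g y) (g y') by lra.
  elim: yy' {Py'} => [[_ Ay]|u v yu IH [Pv Av] uv]; first exact: chain_start.
  by apply: chain_step IH Av (g_step _ _ _ _ uv) => //; case: (chain_last yu).
by move=> y Py; have [i ik Ag] := AX (g y) I; exists i.
Qed.

Definition few_balls j a : set Y := [set y | exists2 s : seq X,
  (size s <= j)%N & forall x, F y x -> exists2 c, c \in s & mdist c x <= a].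

(** If the values at [y] have no gap between the distances [2 * a] and [b], two
    of the balls covering them can be merged. *)
Lemma few_ballsS j a b :
  few_balls j.+1 a `<=` gap (a + a) b `|` few_balls j (3 * a + b).
Proof.
move=> y [s sj sP]; have [|ngap] := pselect (gap (a + a) b y); first by left.
right; have [x [x' [Fx Fx' xx'b xx'a]]] : exists x x',
    [/\ F y x, F y x', mdist x x' <= b & a + a < mdist x x'].
  apply: contrapT => H; apply: ngap => x x' Fx Fx' xx'.
  by rewrite leNgt; apply/negP => lt; apply: H; exists x, x'.
have [c cs cx] := sP x Fx; have [c' cs' cx'] := sP x' Fx'.
have a0 : 0 <= a := le_trans (mdist_ge0 _ _) cx.
have cc' : c != c'.
  apply/eqP => E; rewrite -E in cx'.
  by have := metric_triangle x c x'; rewrite (metric_sym x c); lra.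
exists (rem c' s).
  by rewrite size_rem//; case: (size s) sj.
move=> z Fz; have [d ds dz] := sP z Fz; have [E|dc'] := eqVneq d c'.
  exists c; first by rewrite rem_mem.
  rewrite E in dz; have := metric_triangle c x z; have := metric_triangle x x' z.
  by have := metric_triangle x' c' z; rewrite (metric_sym x' c'); lra.
exists d; first by rewrite rem_mem.
by have := mdist_ge0 x x'; lra.
Qed.

Lemma few_balls_dim k : uniform_dim (X := X) k ->
  forall j a r, 0 < r -> exists D, scale_dim k r D (few_balls j a).
Proof.
move=> dimX; elim=> [a r r0|j IH a r r0].
  exists 0; apply: scale_dim_sub (scale_dim0 k r) => // y [[|//] _ sP].
  by have [x /sP[]] := F_neq0 y.
have [||D1 [b dim1]] := scale_dim_local_to_global (k := k)
    (G := gap (a + a)) _ (correspondence_finite_dim dimX) _ r0.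
- move=> b b' bb' y gapy x x' Fx Fx' xx'; apply: gapy => //.
  exact: le_trans bb'.
- exact: gap_local_dim.
have D10 : 0 <= D1 by case: dim1.
have [|D2 dim2] := IH (3 * a + b) (D1 + r + r); first lra.
exists (D2 + 2 * (D1 + r)).
apply: scale_dim_sub (scale_dim_setU (ltW r0) (lexx _) dim1 dim2) => //.
exact: few_ballsS.
Qed.

Lemma correspondence_dim k :
  uniform_dim (X := X) k -> uniform_dim (X := Y) k.
Proof.
move=> dimX r r0; have [S _ cov] := F_covered (ltr01 : (0 : R) < 1).
have [D dimD] := few_balls_dim dimX n S r0; exists D.
apply: scale_dim_sub dimD => // y _; have [s sn sP] := cov y.
by exists s => // x; apply: sP; rewrite mdistxx.
Qed.

End Correspondence.

(** * Coarse maps *)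

Section Maps.
Context {R : realType} {X Y : metricType R}.
Implicit Types (f : X -> Y) (x : X) (y : Y) (r t u : R).

Lemma proper_map_ball f x0 : proper_map f ->
  forall r, exists s, forall x, mdist (f x) (f x0) <= r -> mdist x x0 <= s.
Proof.
move=> fprop r; have /fprop/boundedP[s fs] :
    bounded [set y | mdist (f x0) y <= Num.max r 0].
  exact: (@bounded_in_ball _ _ _ (f x0) (Num.max r 0)).
exists s => x fx; apply: fs => /=.
  by rewrite metric_sym le_max fx.
by rewrite mdistxx le_max lexx orbT.
Qed.

Lemma coarsely_n_to_1_balls n f (x0 : X) : coarsely_n_to_1 n f ->
  forall r, 0 < r -> exists2 S, 0 < S & forall A : set Y, diam_le A r ->
    exists2 s : seq X, (size s <= n)%N &
      forall x, A (f x) -> exists2 c, c \in s & mdist c x <= S.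
Proof.
move=> fn r r0; have [S S0 fS] := fn r r0; exists S => // A /diam_leP/fS.
move=> [B BS AB]; have /choice[c cP] i : exists c, forall x, B i x -> B i c.
  have [[c Bc]|B0] := pselect (B i !=set0); first by exists c.
  by exists x0 => x Bx; case: B0; exists x.
exists [seq c i | i <- enum 'I_n]; first by rewrite size_map size_enum_ord.
move=> x /AB[i _ Bx]; exists (c i); first by apply: map_f; rewrite mem_enum.
by have /diam_leP := BS i; apply => //; exact: cP Bx.
Qed.

(** Pull a colouring of [Y] back. An [r]-chain of one colour is sent into one
    component, so it lies in a set covered by [n] balls of controlled radius. *)
Lemma uniform_dim_domain n f (x0 : X) k : coarse f -> coarsely_n_to_1 n f ->
  uniform_dim (X := Y) k -> uniform_dim (X := X) k.
Proof.
move=> [_ fcoarse] fn dimY r r0; have [s s0 fs] := fcoarse r r0.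
have [D [D0 [A Ab AY]]] := dimY s s0.
have [|S S0 fS] := coarsely_n_to_1_balls x0 fn (r := D + 1); first lra.
have [D' D'0 bound] := chain_bounded_cover (X := X) n (ltW r0) (ltW S0).
exists D'; split=> //; exists (fun i => f @^-1` A i) => [i ik x y xy|x _].
  have comp_le : diam_le [set z | chain (A i) s (f x) z] (D + 1).
    move=> z z' /= xz xz'; suff /(Ab i ik) : chain (A i) s z z' by lra.
    by apply: chain_trans xz'; exact: chain_sym.
  have [l ln cov] := fS _ comp_le.
  pose comp := [set z | chain (f @^-1` A i) r x z].
  apply: (bound comp l) => // [z xz|].
    apply: cov => /=; elim: xz => [Ax|u v _ IH Av uv]; first exact: chain_start.
    by apply: chain_step IH Av _; exact: fs.
  elim: xy => [Ax|u v xu IH Av uv].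
    by apply: chain_start; exact: chain_start.
  by apply: chain_step IH _ (uv); exact: chain_step xu Av uv.
by have [i ik Ax] := AY (f x) I; exists i.
Qed.

Lemma coarsely_surjective_ball f (x0 : X) : coarsely_surjective f ->
  exists2 R0, 0 < R0 & forall y, exists x, mdist (f x) y <= R0.
Proof.
move=> [r fr]; exists (`|r| + 1); first by rewrite ltr_wpDl.
move=> y; have [||_ [_ [x _ <-] <-] lt] :=
    @inf_lt _ [set mdist y a | a in range f] (`|r| + 1).
- by exists (mdist y (f x0)); exists (f x0).
- by have := fr y; have := ler_norm r; lra.
- by exists x; rewrite metric_sym ltW.
Qed.

(** Coarse openness, although stated with slowly growing radii, gives a lifting
    property with constants. Otherwise, for some [r], there are pairs of points
    [x_k] and [y_k] with [mdist (f x_k) y_k <= r] such that no point within [k]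
    of [x_k] is sent close to [y_k]; they can be taken as far out as desired, as
    coarse surjectivity and properness provide liftings over a bounded set.
    Take them so sparse that the [f x_k] are far from each other, and [rho] so
    slow that it is at most [k] at [x_k]. Applied to the set of all [x_k],
    openness provides for a large [k] some [x'] with [f x' = y_k] within [j] of
    some [x_j]; sparseness forces [j = k], a contradiction. *)
Lemma coarsely_open_lift f x0 y0 :
  coarse f -> coarsely_open x0 y0 f -> coarsely_surjective f ->
  exists2 R0, 0 < R0 & (forall y, exists x, mdist (f x) y <= R0) /\
    forall r, 0 < r -> exists S, forall x y, mdist (f x) y <= r ->
      exists2 x', mdist x x' <= S & mdist (f x') y <= R0.
Proof.
move=> [fprop fcoarse] fopen /(coarsely_surjective_ball x0)[R0 R00 fR0].
exists R0 => //; split=> // r r0; apply: contrapT => nolift.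
pose bad S (p : X * Y) := mdist (f p.1) p.2 <= r /\
  forall x', mdist p.1 x' <= S -> R0 < mdist (f x') p.2.
have bad_ex S : exists p, bad S p.
  apply: contrapT => nobad; apply: nolift; exists S => x y xy.
  apply: contrapT => nox'; apply: nobad; exists (x, y); split=> // x' xx'.
  by rewrite ltNge; apply/negP => x'y; apply: nox'; exists x'.
have /choice[Kf KfP] := proper_map_ball x0 fprop.
have bad_far S K : exists p, bad S p /\ K < mdist p.1 x0.
  apply: contrapT => H; have {}H p : bad S p -> mdist p.1 x0 <= K.
    by move=> bp; rewrite leNgt; apply/negP => lt; apply: H; exists p.
  have [|s _ fs] := fcoarse (`|K| + 1); first by rewrite ltr_wpDl.
  have [p [pr pfar]] := bad_ex (Num.max S (K + Kf (R0 + r + s))).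
  have px0 : mdist p.1 x0 <= K.
    by apply: H; split=> // x' px'; apply: pfar; rewrite le_max px'.
  have [x' x'p] := fR0 p.2.
  have fpx0 : mdist (f p.1) (f x0) <= s.
    by apply: fs; have := ler_norm K; lra.
  have : mdist x' x0 <= Kf (R0 + r + s).
    apply: KfP; have := metric_triangle (f x') p.2 (f x0).
    have := metric_triangle p.2 (f p.1) (f x0).
    by rewrite (metric_sym p.2 (f p.1)); lra.
  move=> x'x0; suff : R0 < mdist (f x') p.2 by rewrite ltNge x'p.
  apply: pfar; rewrite le_max; apply/orP; right.
  by have := metric_triangle p.1 x0 x'; rewrite (metric_sym x0); lra.
have /choice[h hP] (j : nat) : exists s, 0 < s /\
    forall x x', mdist x x' <= j%:R + 1 -> mdist (f x) (f x') <= s.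
  have [|s s0 fs] := fcoarse (j%:R + 1 : R); first by rewrite ltr_wpDl.
  by exists s.
pose H k := \sum_(i < k.+1) h i.
have hH j k : (j <= k)%N -> h j <= H k.
  rewrite /H -ltnS => jk; rewrite (bigD1 (Ordinal jk))//= lerDl.
  by apply: sumr_ge0 => i _; exact: ltW (hP i).1.
have H0 k : 0 < H k := lt_le_trans (hP k).1 (hH k k (leqnn k)).
have /choice[b bP] (SK : R * R) : exists p, bad SK.1 p /\ SK.2 < mdist p.1 x0.
  exact: bad_far.
pose d (p : X * Y) := mdist p.1 x0; pose u (p : X * Y) := mdist (f p.1) (f x0).
pose next k q := b (k.+1%:R, Num.max (d q + 1) (Kf (u q + r + H k.+1))).
pose p := fix p k := if k is k'.+1 then next k' (p k') else b (0, 0).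
have p_bad k : bad k%:R (p k) by case: k => [|k]; exact: (bP _).1.
have d_step k : d (p k) + 1 < d (p k.+1).
  have := (bP (k.+1%:R, Num.max (d (p k) + 1) (Kf (u (p k) + r + H k.+1)))).2.
  by rewrite /= gt_max => /andP[].
have u_step k : u (p k) + r + H k.+1 < u (p k.+1).
  have := (bP (k.+1%:R, Num.max (d (p k) + 1) (Kf (u (p k) + r + H k.+1)))).2.
  rewrite /= gt_max => /andP[_ lt]; rewrite ltNge; apply/negP => /KfP.
  by rewrite leNgt lt.
have d_ge k : k%:R <= d (p k).
  elim: k => [|k IH]; first exact: mdist_ge0.
  by rewrite -natr1; have := d_step k; lra.
have d_mono j k : (j <= k)%N -> d (p j) <= d (p k).
  elim: k => [|k IH]; first by rewrite leqn0 => /eqP->.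
  rewrite leq_eqVlt => /predU1P[->//|]; rewrite ltnS => /IH.
  by have := d_step k; lra.
have u_sparse j k : (j < k)%N -> u (p j) + r + H k < u (p k).
  elim: k => // k IH; rewrite ltnS leq_eqVlt => /predU1P[->//|/IH].
  by have := u_step k; have := H0 k; lra.
have above t : exists N, t < N%:R.
  by exists (Num.bound `|t|); apply: le_lt_trans (ler_norm t) (archi_boundP _).
have reach t : exists k, t <= d (p k).
  by have [N tN] := above t; exists N; apply: le_trans (ltW tN) (d_ge N).
pose level t := ex_minn (reach t); pose rho t : R := (level t)%:R.
have level_le t k : t <= d (p k) -> (level t <= k)%N.
  by rewrite /level; case: ex_minnP => m _; apply.
have level_ge t : t <= d (p (level t)) by rewrite /level; case: ex_minnP.
have rhoTI : TI_increasing rho.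
  split=> [t _|s t _ st|]; first exact: ler0n.
    by rewrite ler_nat; apply: level_le; exact: le_trans (level_ge t).
  apply/cvgryPge => M; have [N MN] := above M; near=> t.
  have tN : d (p N) < t by near: t; exact: nbhs_pinfty_gt (num_real _).
  apply: le_trans (ltW MN) _; rewrite ler_nat leqNgt; apply/negP => /ltnW/d_mono.
  by have := level_ge t; lra.
pose A := range (fun k => (p k).1).
have unbA : ~ bounded A.
  move=> /boundedP[D AD]; have [N ND] := above (D + d (p 0%N)).
  have : mdist (p N).1 (p 0%N).1 <= D by apply: AD; [exists N|exists 0%N].
  have := metric_triangle (p N).1 (p 0%N).1 x0; have := d_ge N.
  by rewrite /d in ND *; lra.
have [rho' [_ _ /cvgryPge/(_ r)[M [_ rho'r]]] sub] := fopen A rho unbA rhoTI.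
have [k kfar] := above (Kf (M + mdist (f x0) y0)).
have far : M < mdist (f (p k).1) y0.
  rewrite ltNge; apply/negP => le.
  have : d (p k) <= Kf (M + mdist (f x0) y0).
    apply: KfP; have := metric_triangle (f (p k).1) y0 (f x0).
    by rewrite (metric_sym y0); lra.
  by have := d_ge k; lra.
have [|x' [_ [j _ <-] /= x'j] fx'] := sub (p k).2.
  exists (f (p k).1); first by exists (p k).1 => //; exists k.
  by apply: le_trans (p_bad k).1 _; exact: rho'r.
have {}x'j : mdist (p j).1 x' <= j%:R.
  by apply: le_trans x'j _; rewrite ler_nat; exact: level_le.
have fjk : mdist (f (p j).1) (f (p k).1) <= h j + r.
  have : mdist (f (p j).1) (p k).2 <= h j.
    by rewrite -fx'; apply: (hP j).2; lra.
  have := metric_triangle (f (p j).1) (p k).2 (f (p k).1).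
  by have := (p_bad k).1; rewrite (metric_sym (p k).2); lra.
have [jk|kj|E] := ltngtP j k.
- have := u_sparse _ _ jk; have := hH j k (ltnW jk).
  have := metric_triangle (f (p k).1) (f (p j).1) (f x0).
  by rewrite /u (metric_sym (f (p k).1) (f (p j).1)); lra.
- have := u_sparse _ _ kj; have := hH j j (leqnn j).
  by have := metric_triangle (f (p j).1) (f (p k).1) (f x0); rewrite /u; lra.
- rewrite E in x'j; have := (p_bad k).2 _ x'j; rewrite fx' mdistxx.
  by have := R00; lra.
Unshelve. all: by end_near. Qed.

(** The fibres [F y] of points of [X] sent within [R0] of [y] make up the
    multivalued inverse of [f] to which [correspondence_dim] applies. *)
Lemma uniform_dim_codomain n f x0 y0 k :
  coarse f -> coarsely_open x0 y0 f -> coarsely_n_to_1 n f ->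
  coarsely_surjective f ->
  uniform_dim (X := X) k -> uniform_dim (X := Y) k.
Proof.
move=> fcoarse fopen fn fsurj.
have [R0 R00 [fR0 lift]] := coarsely_open_lift fcoarse fopen fsurj.
pose F y := [set x | mdist (f x) y <= R0].
apply: (@correspondence_dim _ _ _ n F) => [y|r r0|r r0|r r0].
- by have [x] := fR0 y; exists x.
- have [|S fS] := lift (R0 + r); first lra.
  exists S => y y' x yy' Fx; have [|x' xx' Fx'] := fS x y'; last by exists x'.
  by have := metric_triangle (f x) y y'; rewrite /F /= in Fx; lra.
- have [|S S0 fS] := coarsely_n_to_1_balls x0 fn (r := (r + R0) + (r + R0)).
    lra.
  exists S => // y; have [|s sn sP] := fS [set z | mdist y z <= r + R0].
    move=> z z' /= yz yz'.
    by have := metric_triangle z y z'; rewrite (metric_sym z y); lra.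
  exists s => // y' x yy' Fx; apply: sP => /=; rewrite /F /= metric_sym in Fx.
  by have := metric_triangle y y' (f x); lra.
- have [s s0 fs] := fcoarse.2 r r0; exists (R0 + s + R0).
  move=> y y' x x' Fx Fx' /fs xx'; rewrite /F /= in Fx Fx'.
  have := metric_triangle y (f x) y'; have := metric_triangle (f x) (f x') y'.
  by rewrite (metric_sym y (f x)); lra.
Qed.

End Maps.

Theorem theorem5p8 (R : realType) (n : nat) (X Y : metricType R)
    (x0 : X) (y0 : Y) (f : X -> Y) :
  (0 < n)%N -> proper_space X -> proper_space Y ->
  coarse f -> coarsely_open x0 y0 f -> coarsely_n_to_1 n f ->
  coarsely_surjective f ->
  asdim Y = asdim X.
Proof.
move=> _ _ _ fcoarse fopen fn fsurj; congr (ereal_inf (_ @` _)).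
apply/seteqP; split=> m /asdim_le_uniform_dim dimm; apply: uniform_dim_asdim_le.
- exact: (uniform_dim_domain x0 fcoarse fn dimm).
- exact: (uniform_dim_codomain fcoarse fopen fn fsurj dimm).
Qed.
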